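(* Let $g=2k$ with $k\ge 2$. The number of $\mathfrak{S}_{2g+2}$-orbits of spin structures of $\Sigma_g$ is $k+1$. The orbits are $\mathcal{C}_0,\mathcal{C}_1,\dots,\mathcal{C}_k$, and a representative of the orbit $\mathcal{C}_m$ is given by the spin structure whose corresponding matrix is $M_m$, where $M_0$ is the $2\times g$ zero matrix and $M_m=\begin{pmatrix}A_m & 0\end{pmatrix}$ for $1\le m\le k$ (all columns after the block $A_m$ being zero).
   Context: $\Sigma_g$ is a compact connected oriented surface of genus $g$, and $\alpha_1,\dots,\alpha_g,\beta_1,\dots,\beta_g$ is a symplectic basis of $H_1(\Sigma_g,\mathbb{Z}/2)$, i.e. $\alpha_i\cdot\beta_j=\delta_{ij}$, $\alpha_i\cdot\alpha_j=\beta_i\cdot\beta_j=0$ for the mod 2 intersection number. A spin structure is a map $c:H_1(\Sigma_g,\mathbb{Z}/2)\to\mathbb{Z}/2$ with $c(x+y)=c(x)+c(y)+x\cdot y$ for all $x,y$; $\mathcal{C}$ is the set of spin structures. The corresponding matrix of $c$ is the $2\times g$ matrix $M$ over $\mathbb{Z}/2$ whose $i$-th column is $\begin{pmatrix}c(\alpha_i)\\c(\beta_i)\end{pmatrix}$; it determines $c$, and every $2\times g$ matrix over $\mathbb{Z}/2$ arises. For $\gamma\in H_1(\Sigma_g,\mathbb{Z}/2)$ let $T_\gamma(x)=x+(x\cdot\gamma)\gamma$, an element of the group $Sp_{2g}(\mathbb{Z}/2)$ of automorphisms preserving the intersection number. Let $\sigma_i=(i,i+1)\in\mathfrak{S}_{2g+2}$,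 $1\le i\le 2g+1$, where $\mathfrak{S}_n$ is the symmetric group. The group $\mathfrak{S}_{2g+2}$ acts through the homomorphism $\iota:\mathfrak{S}_{2g+2}\to Sp_{2g}(\mathbb{Z}/2)$ determined by $\iota(\sigma_1)=T_{\beta_1}$, $\iota(\sigma_{2g+1})=T_{\beta_g}$, $\iota(\sigma_{2i})=T_{\alpha_i}$ ($1\le i\le g$), $\iota(\sigma_{2j+1})=T_{\beta_j+\beta_{j+1}}$ ($1\le j\le g-1$). It acts on $\mathcal{C}$ from the right by $c\circ\sigma:=c\circ\iota(\sigma)$. For $i\ge1$, $A_i$ is the $2\times(2i-1)$ matrix over $\mathbb{Z}/2$ whose odd-numbered columns are $\begin{pmatrix}1\\1\end{pmatrix}$ and whose even-numbered columns are $\begin{pmatrix}1\\0\end{pmatrix}$. *)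

(* Defs.v *)
From HB Require Import structures.
From mathcomp Require Export all_boot all_fingroup all_order all_algebra.

Set Implicit Arguments.
Unset Strict Implicit.
Unset Printing Implicit Defensive.

Import GRing.Theory.
Local Open Scope ring_scope.

(* The pair (V, dot) stands for H_1(Sigma_g, Z/2) with its mod 2 intersection
   number.  Indices in 'I_g start at 0: alpha_(i+1) is [alpha i]. *)

Section Spin.

Variables (V : finLmodType 'F_2) (dot : {biscalar V}).
Variables (g : nat) (alpha beta : 'I_g -> V).

Definition alternating := forall x : V, dot x x = 0.

Definition symplectic_basis :=
  [/\ forall x : V, exists! ab : 'rV['F_2]_g * 'rV['F_2]_g,
        x = \sum_i ab.1 0 i *: alpha i + \sum_i ab.2 0 i *: beta i,
      forall i j, dot (alpha i) (beta j) = (i == j)%:R,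
      forall i j, dot (alpha i) (alpha j) = 0
    & forall i j, dot (beta i) (beta j) = 0].

Definition spin_structures : {set {ffun V -> 'F_2}} :=
  [set c : {ffun V -> 'F_2} |
     [forall x, forall y, c (x + y) == c x + c y + dot x y]].

Definition spin_matrix (c : {ffun V -> 'F_2}) : 'M['F_2]_(2, g) :=
  \matrix_(r, j) (if r == 0 then c (alpha j) else c (beta j)).

Definition transvection (gamma x : V) : V := x + dot x gamma *: gamma.

Definition Sp : {set {perm V}} :=
  [set f : {perm V} |
     [forall a : 'F_2, forall x, forall y, f (a *: x + y) == a *: f x + f y]
     && [forall x, forall y, dot (f x) (f y) == dot x y]].

(* The transposition (i, i+1) of {1, ..., 2g+2} for 1 <= i <= 2g+1; the point
   p is the element p - 1 of 'I_(2g+2). *)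
Definition sigma (i : nat) : {perm 'I_(2 * g).+2} :=
  tperm (inord i.-1) (inord i).

(* The product of permutations s * t is "s, then t", both in the source and in
   the target of iota, so iota is also a morphism for the composition of maps
   written from right to left. *)
Definition iota_spec
    (iota : {morphism [set: {perm 'I_(2 * g).+2}] >-> {perm V}}) :=
  [/\ forall s, iota s \in Sp,
      forall i : 'I_g, i = 0%N :> nat ->
        iota (sigma 1) =1 transvection (beta i),
      forall i : 'I_g, i.+1 = g ->
        iota (sigma (2 * g).+1) =1 transvection (beta i),
      forall i : 'I_g, iota (sigma (2 * i.+1)) =1 transvection (alpha i)
    & forall i j : 'I_g, j = i.+1 :> nat ->
        iota (sigma (2 * i.+1).+1) =1 transvection (beta i + beta j)].

Variable iota : {morphism [set: {perm 'I_(2 * g).+2}] >-> {perm V}}.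

Definition spin_act (c : {ffun V -> 'F_2}) (s : {perm 'I_(2 * g).+2}) :
  {ffun V -> 'F_2} := [ffun x => c (iota s x)].

Definition spin_orbit (c : {ffun V -> 'F_2}) : {set {ffun V -> 'F_2}} :=
  [set spin_act c s | s : {perm 'I_(2 * g).+2}].

Definition spin_orbits : {set {set {ffun V -> 'F_2}}} :=
  [set spin_orbit c | c in spin_structures].

End Spin.

(* Column j of the matrix is the column numbered j + 1, so the odd-numbered
   columns are those with j even. *)
Definition Amx (i : nat) : 'M['F_2]_(2, (2 * i).-1) :=
  \matrix_(r, j) (if r == 0 then 1 else (~~ odd j)%:R).

(* The matrix (A_m 0) of width g, for 2m - 1 <= g.  As A_0 has no columns here,
   Mmx g 0 is the zero matrix. *)
Definition Mmx (g m : nat) : 'M['F_2]_(2, g) :=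
  \matrix_(r, j) (if insub (val j) is Some j' then Amx m r j' else 0).

(* Main.v *)
From mathcomp Require Import zify ring.
Require Import Defs.
Import GRing.Theory.
Local Open Scope ring_scope.

(* Identify V with the even subsets of the 2g + 2 points modulo complement, so
   that [sigma i] acts through the class of {i, i + 1} and iota becomes the
   permutation action.  Every spin structure is c S = #|S| / 2 + #|S :&: T| mod
   2 for a set T of points, unique up to complement, with #|T| = g + 1 mod 2.
   Two spin structures are in the same orbit iff their sets T have the same
   cardinality, up to complement; for g = 2k this leaves the cardinalities
   1, 3, .., 2k + 1, and the set T of M_m has 2k + 1 - 2m points. *)

Set Implicit Arguments.
Unset Strict Implicit.
Unset Printing Implicit Defensive.

(** * Booleans as elements of ['F_2], permutations and counting *)

Lemma F2_natr_addb (x y : bool) : (x (+) y)%:R = x%:R + y%:R :> 'F_2.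
Proof. by apply/val_inj; case: x; case: y. Qed.

Lemma F2_boolE (x : 'F_2) : x = (x != 0)%:R.
Proof. by apply/val_inj; case: x => [[|[|m]] Hm]. Qed.

Lemma F2_natr_inj (x y : bool) : x%:R = y%:R :> 'F_2 -> x = y.
Proof. by case: x; case: y => // /(congr1 val). Qed.

Lemma F2_addxx (V : lmodType 'F_2) (x : V) : x + x = 0.
Proof.
rewrite -[X in X + _]scale1r -[X in _ + X]scale1r -scalerDl.
by rewrite (_ : 1 + 1 = 0 :> 'F_2) ?scale0r //; apply/val_inj.
Qed.

(** The transpositions of [ord0] with the other points generate, and the one for [j.+1] is the
    conjugate of the one for [j] by an adjacent transposition. *)
Lemma gen_adjacent_tperm n (H : {group {perm 'I_n.+1}}) :
  (forall i, (i < n)%N -> tperm (inord i) (inord i.+1) \in H) ->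
  H = [set: {perm 'I_n.+1}] :> {set _}.
Proof.
move=> adjH; apply/eqP; rewrite eqEsubset subsetT -(gen_tperm ord0) gen_subG.
apply/subsetP=> _ /imsetP[[j ltj] _ ->].
have -> : Ordinal ltj = inord j by apply: val_inj; rewrite /= inordK.
elim: j ltj => [|j IHj] ltj.
  rewrite (_ : inord 0 = ord0) ?tperm1 ?group1 //.
  by apply: val_inj; rewrite /= inordK.
have [->|j_gt0] := posnP j.
  rewrite (_ : ord0 = inord 0) ?adjH //; first by lia.
  by apply: val_inj; rewrite /= inordK.
have ->: tperm (ord0 : 'I_n.+1) (inord j.+1) =
  (tperm ord0 (inord j) ^ tperm (inord j) (inord j.+1))%g.
  by rewrite tpermJ tpermL tpermD // -val_eqE /= !inordK //; lia.
by rewrite groupJ ?adjH ?IHj //; lia.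
Qed.

(** The membership tuples of [A] and [B] have equally many entries [true] and equally many [false],
    so one is a rearrangement of the other. *)
Lemma perm_preim_set n (A B : {set 'I_n}) :
  #|A| = #|B| -> exists s : {perm 'I_n}, forall i, (s i \in A) = (i \in B).
Proof.
move=> eqAB.
have cardE (C : {set 'I_n}) : count id (map (mem C) (enum 'I_n)) = #|C|.
  by rewrite count_map enumT -size_filter cardE; congr size; apply: eq_filter.
have /tuple_permP[s Es] :
    perm_eq [tuple i \in B | i < n] [tuple i \in A | i < n].
  apply/allP=> x _ /=; apply/eqP.
  have countT (C : {set 'I_n}) :
      count_mem true [seq i \in C | i <- enum 'I_n] = #|C|.
    by rewrite -cardE; apply: eq_count => -[].
  have countF (C : {set 'I_n}) :
      count_mem false [seq i \in C | i <- enum 'I_n] = (n - #|C|)%N.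
    rewrite -cardE -[X in (X - _)%N](size_enum_ord n).
    rewrite -(size_map (fun i => i \in C)) -(count_predC id) addKn.
    by apply: eq_count => -[].
  by case: x; rewrite ?countT ?countF eqAB.
exists s => i; move/val_inj/(congr1 (fun t => tnth t i)): Es.
by rewrite !tnth_mktuple.
Qed.

Lemma card_even_ge n m : (m <= n)%N ->
  #|[set p : 'I_(2 * n) | (2 * m <= p)%N && ~~ odd p]| = (n - m)%N.
Proof.
move=> lemn; rewrite -sum1_card big_mkcond /=.
under eq_bigr do rewrite inE.
elim: n lemn => [|n IHn] lemn; first by rewrite muln0 big_ord0.
rewrite (_ : 2 * n.+1 = (2 * n).+2)%N ?mulnS // !big_ord_recr /=.
have [ltmn|] := ltnP m n.+1.
  rewrite IHn // !oddM /= andbF andbT (_ : (2 * m <= 2 * n)%N = true) /=; lia.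
move=> lenm; rewrite big1 => [|i _].
  by case: ifP; case: ifP; lia.
by case: ifP => //; have := ltn_ord i; lia.
Qed.

(** * Classes of pairs of points and their intersection numbers *)

Section Points.

Variables (g : nat) (V : finLmodType 'F_2) (dot : {biscalar V}).
Variables (alpha beta : 'I_g -> V).
Hypothesis dot_alt : alternating dot.
Hypothesis basis_V : symplectic_basis dot alpha beta.

Lemma dotC x y : dot x y = dot y x.
Proof.
have := dot_alt (x + y); rewrite linearDl !linearDr !dot_alt add0r addr0 => E.
by move/eqP: E; rewrite addr_eq0 (oppr_pchar2 (pchar_Fp _)) // => /eqP.
Qed.

(* [alpha0 i] is alpha_(i+1), but [beta0 i] is beta_i; beta_0 = beta_(g+1) = 0
   makes the formulas for the classes of {2i + 1, 2i + 2} uniform in i. *)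
Definition alpha0 (i : nat) : V := oapp alpha 0 (insub i).
Definition beta0 (i : nat) : V :=
  if i is j.+1 then oapp beta 0 (insub j) else 0.

Lemma alpha0E (i : 'I_g) : alpha0 i = alpha i.
Proof. by rewrite /alpha0 valK. Qed.

Lemma beta0E (i : 'I_g) : beta0 i.+1 = beta i.
Proof. by rewrite /beta0 valK. Qed.

Lemma beta0_out : beta0 g.+1 = 0.
Proof. by rewrite /= insubF ?ltnn. Qed.

Lemma dot_alpha0 i j : dot (alpha0 i) (alpha0 j) = 0.
Proof.
rewrite /alpha0; case: insubP => [i' _ _|_] /=; last by rewrite linear0l.
case: insubP => [j' _ _|_] /=; last by rewrite linear0r.
by case: basis_V.
Qed.

Lemma dot_beta0 i j : dot (beta0 i) (beta0 j) = 0.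
Proof.
case: i j => [|i] [|j]; rewrite /= ?(linear0l, linear0r) //.
case: insubP => [i' _ _|_] /=; last by rewrite linear0l.
case: insubP => [j' _ _|_] /=; last by rewrite linear0r.
by case: basis_V.
Qed.

Lemma dot_alpha0_beta0 i j :
  dot (alpha0 i) (beta0 j) = ((i < g)%N && (j == i.+1))%:R.
Proof.
case: basis_V => _ ab _ _; rewrite /alpha0.
case: insubP => [i' lti Ei|/negbTE->] /=; last by rewrite linear0l.
rewrite lti; case: j => [|j]; rewrite /= ?linear0r // eqSS -Ei.
case: insubP => [j' _ Ej|/negbTE ltj] /=; first by rewrite ab -Ej eq_sym.
rewrite linear0r; case: eqP => // Ej; by rewrite Ej Ei lti in ltj.
Qed.

Arguments beta0 : simpl never.

(* The class of {1, p + 1}, as the sum of those of {i, i + 1}, 1 <= i <= p. *)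
Definition pt (p : nat) : V := \sum_(i < p./2) alpha0 i + beta0 (uphalf p).

Lemma pt0 : pt 0 = 0.
Proof. by rewrite /pt big_ord0 addr0. Qed.

Lemma pt_even i : pt (2 * i) + pt (2 * i).+1 = beta0 i + beta0 i.+1.
Proof.
rewrite /pt !mul2n /= uphalf_double doubleK.
by rewrite addrACA F2_addxx add0r.
Qed.

Lemma pt_odd i : pt (2 * i).+1 + pt (2 * i.+1) = alpha0 i.
Proof.
rewrite /pt !mul2n /= uphalf_double doubleK big_ord_recr /=.
by rewrite [X in _ + X]addrAC addrA F2_addxx add0r.
Qed.

(** The intersection number is the number of common points mod 2. In coordinates only the two
    alpha-beta terms survive: exactly one of them is 1 when [p] and [q] are distinct and positive,
    and they cancel when [p = q]. *)
Lemma dot_pt p q : (p < (2 * g).+2)%N -> (q < (2 * g).+2)%N ->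
  dot (pt p) (pt q) = [&& p != q, (0 < p)%N & (0 < q)%N]%:R.
Proof.
have sumE r s : (r < (2 * g).+2)%N -> dot (\sum_(i < r./2) alpha0 i) (beta0 s)
   = (0 < s <= r./2)%N%:R.
  move=> ltr; rewrite linear_sumlz.
  under eq_bigr => i _ do rewrite dot_alpha0_beta0.
  case: s => [|s] /=; first by rewrite big1 // => i _; rewrite andbF.
  have [lts|les] := ltnP s r./2; last first.
    rewrite big1 // => i _; rewrite eqSS.
    case: eqP => [Es|]; last by rewrite andbF.
    by have := ltn_ord i; rewrite -Es ltnNge les.
  rewrite (bigD1 (Ordinal lts)) //= big1 ?addr0 => [|i].
    by rewrite eqxx andbT (_ : (s < g)%N) //; lia.
  by rewrite -val_eqE /= eqSS eq_sym => /negbTE ->; rewrite andbF.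
move=> ltp ltq; rewrite /pt linearDl !linearDr dot_beta0 addr0.
rewrite (dotC (beta0 _)) !sumE //.
rewrite [X in X + _ + _](_ : _ = 0); last first.
  rewrite linear_sumlz big1 // => i _; rewrite linear_sumr big1 // => j _.
  exact: dot_alpha0.
rewrite add0r -F2_natr_addb; congr (_%:R).
by case: (ltngtP p q) => pq; lia.
Qed.

(** The coefficient counts the common points of the pair of [pt q] and the adjacent pair; the
    summand [p == 0] is the base point, which lies in every pair [pt q]. *)
Lemma transvection_pt p q : (p.+1 < (2 * g).+2)%N -> (q < (2 * g).+2)%N ->
  transvection dot (pt p + pt p.+1) (pt q) =
  pt q + ((q == p) (+) (q == p.+1) (+) (p == 0%N))%:R *: (pt p + pt p.+1).
Proof.
move=> ltp ltq; rewrite /transvection linearDr !dot_pt // ?(ltnW ltp) //.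
rewrite -F2_natr_addb; congr (_ + _%:R *: _).
by case: p q {ltp ltq} => [|p] [|q] //=; lia.
Qed.

Lemma transvection_D e x y :
  transvection dot e (x + y) = transvection dot e x + transvection dot e y.
Proof. by rewrite /transvection linearDl scalerDl addrACA. Qed.

Lemma transvection_tperm p (q q' : 'I_(2 * g).+2) : (p < (2 * g).+1)%N ->
  transvection dot (pt p + pt p.+1) (pt q + pt q') =
  pt (tperm (inord p) (inord p.+1) q) + pt (tperm (inord p) (inord p.+1) q').
Proof.
move=> ltp.
(* For [p = 0] the transposition moves the base point, which adds an error term. It does not depend
   on [r], so it cancels in a sum of two [pt]. *)
have E (r : 'I_(2 * g).+2) : transvection dot (pt p + pt p.+1) (pt r) =
   pt (tperm (inord p) (inord p.+1) r) + (p == 0%N)%:R *: (pt p + pt p.+1).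
  rewrite transvection_pt // F2_natr_addb scalerDl addrA; congr (_ + _).
  have inordE (s : nat) :
      (s < (2 * g).+2)%N -> val (inord s : 'I_(2 * g).+2) = s.
    by move=> lts; rewrite /= inordK.
  have ltp' : (p < (2 * g).+2)%N by lia.
  case: tpermP => [->|->|/eqP nep /eqP neq].
  - rewrite !inordE // eqxx (_ : p == p.+1 = false) ?scale1r; last lia.
    by rewrite addrA F2_addxx add0r.
  - rewrite !inordE // eqxx (_ : p.+1 == p = false) ?scale1r; last lia.
    by rewrite [pt p + _]addrC addrA F2_addxx add0r.
  move: nep neq; rewrite -!val_eqE !inordE // => /negbTE-> /negbTE->.
  by rewrite scale0r addr0.
by rewrite transvection_D !E addrACA F2_addxx addr0.
Qed.

(** * Spin structures as sets of points up to complement *)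

Lemma spin_add c x y :
  c \in spin_structures dot -> c (x + y) = c x + c y + dot x y.
Proof. by rewrite inE => /forallP/(_ x)/forallP/(_ y)/eqP. Qed.

Lemma spin0 c : c \in spin_structures dot -> c 0 = 0.
Proof.
move=> cP; rewrite -[0](addr0 0) spin_add // linear0l addr0.
by rewrite (addrr_pchar2 (pchar_Fp _)).
Qed.

(* c S = #|S| / 2 + #|S :&: T| for the pairs S of points. *)
Definition labels (c : {ffun V -> 'F_2}) (T : {set 'I_(2 * g).+2}) :=
  forall p q : 'I_(2 * g).+2,
    c (pt p + pt q) = ((p != q) (+) (p \in T) (+) (q \in T))%:R.

(** As [pt 0 = 0], the constant [b] can only be the membership of [ord0] in [T]. Conversely [b]
    cancels on pairs, where [dot_pt] turns the two tests against 0 into the test [p != q]. *)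
Lemma labelsP c (T : {set 'I_(2 * g).+2}) : c \in spin_structures dot ->
  labels c T <-> exists b : bool, forall p : 'I_(2 * g).+2,
    c (pt p) = ((p != 0 :> nat) (+) (p \in T) (+) b)%:R.
Proof.
move=> cP; split=> [cT|[b cE] p q].
  exists (ord0 \in T) => p; have := cT p ord0; rewrite pt0 addr0 => ->.
  by rewrite -val_eqE.
rewrite spin_add // !cE dot_pt // -!F2_natr_addb -val_eqE; congr (_%:R).
by rewrite /=; lia.
Qed.

Lemma labels_exist c : c \in spin_structures dot -> exists T, labels c T.
Proof.
move=> cP.
(* This solves [labelsP] for [p \in T] with [b = false], which selects the set that omits [ord0]. *)
exists [set p : 'I_(2 * g).+2 | (c (pt p) != 0) (+) (p != 0 :> nat)].
apply/labelsP => //; exists false => p; rewrite inE addbF [LHS]F2_boolE.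
by congr (_%:R); case: (c _ == 0); case: (val p == 0)%N.
Qed.

Lemma labels_setC c T : labels c T -> labels c (~: T).
Proof.
move=> cT p q; rewrite cT !inE.
by case: (p \in T); case: (q \in T); case: (p == q).
Qed.

(** Comparing the values on the pairs that contain [ord0] shows that the two indicator functions
    differ by a constant. *)
Lemma labels_unique c T T' : labels c T -> labels c T' -> T' = T \/ T' = ~: T.
Proof.
move=> cT cT'.
have E p : (p \in T') = (p \in T) (+) (ord0 \in T) (+) (ord0 \in T').
  have := cT p ord0; rewrite cT' => /F2_natr_inj.
  by case: (p \in T'); case: (p \in T); case: (_ \in _); case: (_ \in _);
    case: (_ == _).
case: (boolP ((ord0 \in T) (+) (ord0 \in T'))) => [b|/negbTE b]; [right|left].
  by apply/setP=> p; rewrite E -addbA b inE addbT.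
by apply/setP=> p; rewrite E -addbA b addbF.
Qed.

Lemma beta0S j : beta0 j.+1 = beta0 j + (pt (2 * j) + pt (2 * j).+1).
Proof. by rewrite pt_even addrA F2_addxx add0r. Qed.

(** The set of all points has class [beta0 g.+1 = 0]. Splitting it into the g + 1 disjoint pairs {1,
    2}, {3, 4}, ... gives 0 = g + 1 + #|T| mod 2. *)
Lemma odd_card_labels c T :
  c \in spin_structures dot -> labels c T -> odd #|T| = ~~ odd g.
Proof.
move=> cP cT.
pose N j := (\sum_(p < j) ((inord p : 'I_(2 * g).+2) \in T))%N.
(* [beta0 j] is the class of the first [2 * j] points, and [N] counts the elements of [T] among
   them. *)
have cN j : (j <= g.+1)%N -> c (beta0 j) = (odd j (+) odd (N (2 * j)%N))%:R.
  elim: j => [|j IHj] ltj.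
    by rewrite /N big_ord0 spin0.
  rewrite beta0S spin_add // IHj ?(ltnW ltj) // pt_even linearDr !dot_beta0.
  rewrite -pt_even !addr0.
  have inordE s : (s < (2 * g).+2)%N -> val (inord s : 'I_(2 * g).+2) = s.
    by move=> lts; rewrite /= inordK.
  have lt0 : (2 * j < (2 * g).+2)%N by lia.
  have lt1 : ((2 * j).+1 < (2 * g).+2)%N by lia.
  have := cT (inord (2 * j)) (inord (2 * j).+1).
  rewrite -val_eqE !inordE // => ->; rewrite -F2_natr_addb; congr (_%:R).
  rewrite (_ : 2 * j.+1 = (2 * j).+2)%N; last by lia.
  rewrite /N !big_ord_recr /= !oddD !oddb (_ : (_ == _) = false); last by lia.
  by case: (odd j); case: (odd _); case: (_ \in T); case: (_ \in T).
have := cN g.+1 (leqnn _); rewrite beta0_out spin0 // -[0]/(false%:R).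
move/F2_natr_inj; rewrite (_ : 2 * g.+1 = (2 * g).+2)%N; last by lia.
have -> : N (2 * g).+2%N = #|T|.
  rewrite /N -sum1_card [RHS]big_mkcond /=; apply: eq_bigr => p _.
  by rewrite inord_val; case: (p \in T).
by rewrite /=; case: (odd g); case: (odd _).
Qed.

(** Both maps fail additivity by the same term [dot x y], so they agree on a subspace. It contains
    the classes of adjacent pairs, and these span the basis. *)
Lemma spin_eq c c' T :
    c \in spin_structures dot -> c' \in spin_structures dot ->
  labels c T -> labels c' T -> c = c'.
Proof.
move=> cP cP' cT cT'; pose P x := c x = c' x.
have PD x y : P x -> P y -> P (x + y).
  by rewrite /P => Px Py; rewrite !spin_add // Px Py.
have P0 : P 0 by rewrite /P !spin0.
have PZ (a : 'F_2) x : P x -> P (a *: x).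
  by move=> Px; rewrite (F2_boolE a); case: (a != 0); rewrite ?scale1r ?scale0r.
have Ppt p q : (p < (2 * g).+2)%N -> (q < (2 * g).+2)%N -> P (pt p + pt q).
  by move=> ltp ltq; rewrite /P (cT (Ordinal ltp) (Ordinal ltq)) -cT'.
have Palpha i : P (alpha i).
  rewrite -alpha0E -pt_odd; by apply: Ppt; have := ltn_ord i; lia.
have Pbeta0 j : (j <= g)%N -> P (beta0 j).
  elim: j => [|j IHj] ltj //; rewrite beta0S; apply: PD.
    by apply: IHj; lia.
  by apply: Ppt; lia.
have Pbeta i : P (beta i) by rewrite -beta0E; apply: Pbeta0.
apply/ffunP=> x; case: basis_V => /(_ x)[ab [Ex _]] _ _ _; rewrite Ex.
by apply: (PD); apply: (big_ind P P0 PD) => i _; apply: PZ.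
Qed.

Lemma basis_coord x : x =
  \sum_i dot x (beta i) *: alpha i + \sum_i dot x (alpha i) *: beta i.
Proof.
case: basis_V => /(_ x)[ab [Ex _]] dab daa dbb.
rewrite {1}Ex; congr (_ + _); apply: eq_bigr => j _; congr (_ *: _).
  rewrite Ex linearDl !linear_sumlz (bigD1 j) //= big1 => [|i neij].
    rewrite linearZl_LR dab eqxx mulr1 addr0 big1 ?addr0 // => i _.
    by rewrite linearZl_LR dbb mulr0.
  by rewrite linearZl_LR dab (negbTE neij) mulr0.
rewrite Ex linearDl !linear_sumlz [X in _ + X](bigD1 j) //= big1 => [|i _].
  rewrite linearZl_LR dotC dab eqxx mulr1 add0r big1 ?addr0 // => i neij.
  by rewrite linearZl_LR dotC dab eq_sym (negbTE neij) mulr0.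
by rewrite linearZl_LR daa mulr0.
Qed.

Lemma spin_of_matrix (M : 'M['F_2]_(2, g)) :
  exists2 c, c \in spin_structures dot & spin_matrix alpha beta c = M.
Proof.
case: basis_V => _ dab daa dbb.
(* The entries of [M] give the linear part; the product of the two coordinates, summed over [i], is
   a quadratic form whose polarization is [dot]. *)
exists [ffun x => \sum_i (dot x (beta i) * M 0 i + dot x (alpha i) * M 1 i
                          + dot x (beta i) * dot x (alpha i))].
  rewrite inE; apply/forallP=> x; apply/forallP=> y; rewrite !ffunE.
  have -> : dot x y = \sum_i (dot y (beta i) * dot x (alpha i)
                               + dot y (alpha i) * dot x (beta i)).
    rewrite {1}(basis_coord y) linearDr !linear_sumr -big_split /=.
    by apply: eq_bigr => i _; rewrite !linearZr_LR.
  rewrite -!big_split /=; apply/eqP; apply: eq_bigr => i _.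
  by rewrite !linearDl; ring.
apply/matrixP=> r j; rewrite mxE !ffunE.
case: r => [[|[|//]] ltr] /=.
- rewrite (bigD1 j) //= big1 ?addr0 => [|i neij].
    rewrite dab daa eqxx mul1r !(mul0r, mulr0, addr0).
    by congr (M _ _); apply: val_inj.
  by rewrite dab daa eq_sym (negbTE neij) !(mul0r, mulr0, addr0).
- rewrite (bigD1 j) //= big1 ?addr0 => [|i neij].
    rewrite (dotC _ (alpha j)) dab dbb eqxx mul1r !(mul0r, mulr0, add0r, addr0).
    by congr (M _ _); apply: val_inj.
  by rewrite (dotC _ (alpha i)) dab dbb (negbTE neij) !(mul0r, mulr0, addr0).
Qed.

(** Value 1 on an adjacent pair means that both or neither of its points lie in [T], value 0 that
    exactly one does. Here the value is 1 up to point index [4 * m - 1] and 0 afterwards, so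
    membership is constant and then alternates. *)
Lemma labels_Mmx c m : (2 * m <= g)%N -> c \in spin_structures dot ->
  spin_matrix alpha beta c = Mmx g m ->
  labels c [set p : 'I_(2 * g).+2 | (4 * m <= p)%N && ~~ odd p].
Proof.
move=> lem cP cM.
have cM' r i : spin_matrix alpha beta c r i = Mmx g m r i by rewrite cM.
have c_alpha i : (i < g)%N -> c (alpha0 i) = ((2 * i).+2 < 4 * m)%N%:R.
  move=> lti; have := cM' 0 (Ordinal lti); rewrite !mxE /= -alpha0E => ->.
  case: insubP => [j ltj _|gej].
    by rewrite mxE /= (_ : (_ < _)%N = true) //; lia.
  by rewrite (_ : (_ < _)%N = false) //=; move: gej => /=; lia.
have c_beta j : (j <= g.+1)%N -> c (beta0 j) = ((j < 2 * m)%N && odd j)%:R.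
  case: j => [|j] ltj; first by rewrite andbF spin0.
  have [->|neg] := eqVneq j g.
    by rewrite beta0_out spin0 // (_ : (_ < _)%N = false) //; lia.
  have lti : (j < g)%N by lia.
  have := cM' 1 (Ordinal lti); rewrite !mxE /= -beta0E => ->.
  case: insubP => [j' ltj' /= Ej|gej].
    by rewrite mxE /= Ej (_ : (_ < _)%N = true) //; lia.
  by rewrite (_ : (_ < _)%N = false) //=; move: gej => /=; lia.
(* For even [p] the class is a sum of two consecutive [beta0], whose values alternate as long as the
   index stays below [2 * m] and vanish from there on. *)
have c_adj p : (p < (2 * g).+1)%N -> c (pt p + pt p.+1) = (p.+1 < 4 * m)%N%:R.
  move=> ltp; have [podd|peven] := boolP (odd p).
    rewrite (_ : p = (2 * p./2).+1); last by lia.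
    rewrite (_ : (2 * p./2).+2 = 2 * p./2.+1)%N; last by lia.
    by rewrite pt_odd c_alpha; [congr (_%:R); lia | lia].
  rewrite (_ : p = 2 * p./2)%N; last by lia.
  rewrite pt_even spin_add // dot_beta0 addr0 !c_beta; [|lia|lia].
  by rewrite -F2_natr_addb; congr (_%:R); lia.
(* The point [ord0] belongs to the set exactly when [m = 0], which dictates this constant. *)
apply/labelsP => //; exists (m == 0%N) => -[p ltp]; rewrite inE /=.
elim: p ltp => [|p IHp] ltp.
  by rewrite pt0 spin0 //= andbT leqn0 muln_eq0 /=; case: (m == 0%N).
rewrite -[pt p.+1]add0r -(F2_addxx (pt p)) -addrA spin_add //.
rewrite IHp ?(ltnW ltp) // c_adj // linearDr dot_alt add0r.
rewrite dot_pt //; last exact: ltnW.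
rewrite -!F2_natr_addb; congr (_%:R).
have p_odd : p.+1 = (4 * m)%N -> odd p by lia.
rewrite (_ : p != p.+1) ?lt0n /=; last by lia.
case: (ltngtP p.+1 (4 * m)) p_odd => [lt_pm _|lt_mp _|Ep /(_ Ep) ->].
- rewrite (_ : (4 * m <= p)%N = false); last by lia.
  by case: (p == 0%N); case: (m == 0%N).
- rewrite (_ : (4 * m <= p)%N = true); last by lia.
  by case: (p == 0%N); case: (odd p); case: (m == 0%N).
rewrite (_ : (4 * m <= p)%N = false); last by lia.
by case: (p == 0%N); case: (m == 0%N).
Qed.

(** * The permutation action on points and on labelling sets *)

Section Action.

Variable iota : {morphism [set: {perm 'I_(2 * g).+2}] >-> {perm V}}.
Hypothesis iotaP : iota_spec dot alpha beta iota.

Lemma iota_add s x y : iota s (x + y) = iota s x + iota s y.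
Proof.
case: iotaP => /(_ s) + _ _ _ _; rewrite inE => /andP[/forallP/(_ 1) + _].
by move=> /forallP/(_ x)/forallP/(_ y)/eqP; rewrite !scale1r.
Qed.

Lemma iota_dot s x y : dot (iota s x) (iota s y) = dot x y.
Proof.
case: iotaP => /(_ s) + _ _ _ _; rewrite inE => /andP[_ /forallP/(_ x)].
by move=> /forallP/(_ y)/eqP.
Qed.

Lemma iota_adjacent p : (0 < g)%N -> (p < (2 * g).+1)%N ->
  iota (tperm (inord p) (inord p.+1)) =1 transvection dot (pt p + pt p.+1).
Proof.
move=> g_gt0 ltp; case: iotaP => _ iota_first iota_last iota_alpha iota_beta.
have [podd|peven] := boolP (odd p).
  have lti : (p./2 < g)%N by lia.
  have Ep : p = (2 * p./2).+1 by lia.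
  move=> x; have := iota_alpha (Ordinal lti) x.
  rewrite -alpha0E -pt_odd [nat_of_ord _]/=.
  rewrite (_ : (2 * p./2.+1)%N = p.+1) -?Ep //.
  by lia.
have Ep : p = (2 * p./2)%N by lia.
rewrite {3 4}Ep pt_even; have [p0|p_gt0] := posnP p./2.
  move=> x; have := iota_first (Ordinal g_gt0) erefl x.
  rewrite /sigma -beta0E p0 add0r /= => <-.
  by rewrite Ep p0.
have lti : (p./2.-1 < g)%N by lia.
have [ltp2|] := ltnP p./2 g.
  move=> x; have := iota_beta (Ordinal lti) (Ordinal ltp2) _ x.
  rewrite /sigma -!beta0E /= prednK // -Ep => -> //.
move=> lep; have Eg : p./2 = g by lia.
rewrite Eg beta0_out addr0 => x.
have := iota_last (Ordinal lti) _ x; rewrite /sigma -beta0E /= prednK // Eg.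
by rewrite (_ : p = (2 * g)%N) => [->|] //; lia.
Qed.

(** The permutations that satisfy this form a subgroup containing all adjacent transpositions. Pairs
    are needed because a single [pt] depends on the base point, which [s] may move. *)
Lemma iota_pt s (p q : 'I_(2 * g).+2) : (0 < g)%N ->
  iota s (pt p + pt q) = pt (s p) + pt (s q).
Proof.
move=> g_gt0.
pose H := [set s | [forall p : 'I_(2 * g).+2, forall q : 'I_(2 * g).+2,
                    iota s (pt p + pt q) == pt (s p) + pt (s q)]].
have HP t : reflect (forall p q : 'I_(2 * g).+2,
    iota t (pt p + pt q) = pt (t p) + pt (t q)) (t \in H).
  rewrite inE; apply: (iffP forallP) => [Ht p' q'|Ht p'].
    by move/forallP/(_ q')/eqP: (Ht p').
  by apply/forallP=> q'; rewrite Ht.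
have group_H : group_set H.
  apply/group_setP; split=> [|t u /HP Ht /HP Hu]; apply/HP=> p' q'.
    by rewrite morph1 !perm1.
  by rewrite morphM ?inE // !permM Ht Hu.
suff /setP/(_ s) : Group group_H = [set: {perm 'I_(2 * g).+2}] :> {set _}.
  by rewrite [RHS]inE => /HP.
apply: gen_adjacent_tperm => i lti; apply/HP=> p' q'.
by rewrite iota_adjacent ?transvection_tperm.
Qed.

Lemma spin_act_spin c s :
  c \in spin_structures dot -> spin_act iota c s \in spin_structures dot.
Proof.
move=> cP; rewrite inE; apply/forallP=> x; apply/forallP=> y.
by rewrite !ffunE iota_add spin_add // iota_dot.
Qed.

(** The acted structure evaluates [c] on the pair of images under [s], hence the preimage of [T]. *)
Lemma labels_act c s T : (0 < g)%N ->
  labels c T -> labels (spin_act iota c s) (s @^-1: T).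
Proof.
by move=> g_gt0 cT p q; rewrite ffunE iota_pt // cT !inE (inj_eq perm_inj).
Qed.

(** Some permutation pulls [T] back to [T'], and a labelling set determines its spin structure. *)
Lemma labels_card_orbit c c' T T' : (0 < g)%N ->
    c \in spin_structures dot -> c' \in spin_structures dot ->
    labels c T -> labels c' T' -> #|T| = #|T'| ->
  exists s, c' = spin_act iota c s.
Proof.
move=> g_gt0 cP cP' cT cT' /perm_preim_set[s sT]; exists s.
apply: (spin_eq cP' (spin_act_spin s cP) cT').
have := labels_act s g_gt0 cT.
by rewrite (_ : s @^-1: T = T') //; apply/setP=> i; rewrite inE sT.
Qed.

(** Precomposition makes [iota s] act first, and [s * t] means [s] first; this is why the factors
    appear in this order. *)
Lemma spin_actM c s t :
  spin_act iota (spin_act iota c t) s = spin_act iota c (s * t)%g.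
Proof. by apply/ffunP=> x; rewrite !ffunE morphM ?inE // permM. Qed.

Lemma spin_act1 c : spin_act iota c 1%g = c.
Proof. by apply/ffunP=> x; rewrite ffunE morph1 perm1. Qed.

Lemma spin_orbit_act c s :
  spin_orbit iota (spin_act iota c s) = spin_orbit iota c.
Proof.
apply/setP=> d; apply/imsetP/imsetP=> -[t _ ->].
  by exists (t * s)%g; rewrite ?inE // spin_actM.
by exists (t * s^-1)%g; rewrite ?inE // spin_actM mulgKV.
Qed.

End Action.
End Points.

(** * Representatives and number of orbits *)

Theorem theorem3p6 (k g : nat) (hk : (2 <= k)%N) (hg : g = (2 * k)%N)
  (V : finLmodType 'F_2) (dot : {biscalar V}) (dot_alt : alternating dot)
  (alpha beta : 'I_g -> V) (basis_V : symplectic_basis dot alpha beta)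
  (iota : {morphism [set: {perm 'I_(2 * g).+2}] >-> {perm V}})
  (iotaP : iota_spec dot alpha beta iota) :
  #|spin_orbits dot iota| = k.+1 /\
  exists C : 'I_k.+1 -> {set {ffun V -> 'F_2}},
    [/\ injective C,
        spin_orbits dot iota = [set C m | m : 'I_k.+1]
      & forall m : 'I_k.+1, exists c : {ffun V -> 'F_2},
          [/\ c \in spin_structures dot,
              spin_matrix alpha beta c = Mmx g m
            & C m = spin_orbit iota c]].
Proof.
have g_gt0 : (0 < g)%N by lia.
have repP (m : 'I_k.+1) : exists c : {ffun V -> 'F_2},
    (c \in spin_structures dot) && (spin_matrix alpha beta c == Mmx g m).
  have [c cP cM] := spin_of_matrix dot_alt basis_V (Mmx g m).
  by exists c; rewrite cP cM eqxx.
pose rep m := xchoose (repP m).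
have rep_spin m : rep m \in spin_structures dot.
  by case/andP: (xchooseP (repP m)).
have rep_mx m : spin_matrix alpha beta (rep m) = Mmx g m.
  by case/andP: (xchooseP (repP m)) => _ /eqP.
have rep_labels (m : 'I_k.+1) :
    exists2 T, labels alpha beta (rep m) T & #|T| = ((2 * k).+1 - 2 * m)%N.
  exists [set p : 'I_(2 * g).+2 | (4 * m <= p)%N && ~~ odd p].
    by apply: (labels_Mmx dot_alt basis_V) => //; have := ltn_ord m; lia.
  have le2m : (2 * m <= g.+1)%N by have := ltn_ord m; lia.
  by have := @card_even_ge _ _ le2m; rewrite mulnA mulnS hg.
pose C m := spin_orbit iota (rep m).
have C_inj : injective C.
  move=> m m' eqC; have : rep m \in C m'.
    by rewrite -eqC; apply/imsetP; exists 1%g; rewrite ?inE ?spin_act1.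
  case/imsetP=> s _ Em; have [T mT cardT] := rep_labels m.
  have [T' mT' cardT'] := rep_labels m'.
  have := labels_act dot_alt basis_V iotaP s g_gt0 mT'; rewrite -Em.
  move/(labels_unique mT) => E.
  have cardE := card_preimset T' (@perm_inj _ s).
  have ltm := ltn_ord m; have ltm' := ltn_ord m'.
  apply: val_inj => /=; move: cardE; rewrite cardT'.
  (* Equality gives 2k + 1 - 2m = 2k + 1 - 2m'. The complement has 2k + 1 + 2m points, so that case
     forces m = m' = 0. *)
  case: E => ->; rewrite ?(cardsCs (~: T)) ?setCK ?card_ord cardT ?hg.
    by clear -ltm ltm'; lia.
  by clear -ltm ltm'; lia.
have orbitsE : spin_orbits dot iota = [set C m | m : 'I_k.+1].
  apply/setP=> O; apply/imsetP/imsetP=> [[c cP ->]|[m _ ->]]; last first.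
    by exists (rep m).
  have [T cT] := labels_exist dot_alt basis_V cP.
  (* Of [T] and its complement, which together have 4k + 2 points, take one with at most half of
     them; its cardinality is odd as [g] is even. *)
  have [T' [cT' oddT' leT']] : exists T',
      [/\ labels alpha beta c T', odd #|T'| & (#|T'| <= (2 * k).+1)%N].
    have oddT U : labels alpha beta c U -> odd #|U|.
      move/(odd_card_labels basis_V cP) => ->.
      by rewrite hg mul2n odd_double.
    have [leT|gtT] := leqP #|T| (2 * k).+1.
      by exists T; split; rewrite ?oddT.
    have cTC := labels_setC cT; exists (~: T); split; rewrite ?oddT //.
    by rewrite cardsCs setCK card_ord; lia.
  (* This index solves #|T'| = 2k + 1 - 2m; the halving is exact because both cardinalities are
     odd. *)
  have ltm : (((2 * k).+1 - #|T'|)./2 < k.+1)%N by clear; lia.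
  exists (Ordinal ltm) => //; have [U mU cardU] := rep_labels (Ordinal ltm).
  have [|s Es] :=
    labels_card_orbit dot_alt basis_V iotaP g_gt0 cP (rep_spin _) cT' mU.
    rewrite cardU [nat_of_ord _]/=; move: oddT' leT'; clear.
    by move: #|T'| => t; lia.
  by rewrite /C Es spin_orbit_act.
split; first by rewrite orbitsE card_imset // card_ord.
exists C; split=> // m; exists (rep m); split=> //.
Qed.
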